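(* Let $f:\mathbb{R}^d\to\mathbb{R}$ be convex and $1$-smooth, let $h:\mathbb{R}^d\to\mathbb{R}\cup\{+\infty\}$ be proper, closed and convex, and let $F=f+h$. For $n\ge2$, the iterates $x_0,\dots,x_n$ of the composite extension of the ($n$-step) method OGM-G, with associated subgradients $s_k\in\partial h(x_k)$, satisfy $$\|\nabla f(x_n)+s_n\|^2\le\frac{2(\sqrt5-1)}{\theta_n^2}\big(F(x_0)-F(x_n)\big).$$ Moreover $\dfrac{2(\sqrt5-1)}{\theta_n^2}\sim\dfrac{4(\sqrt5-1)}{n^2}$ as $n\to\infty$.
   Context: For each $n$, the sequence $\theta_0,\dots,\theta_n$ is defined by $\theta_0=1$, $\theta_i=\frac{1+\sqrt{1+4\theta_{i-1}^2}}{2}$ for $1\le i\le n-1$, and $\theta_n=\frac{1+\sqrt{1+8\theta_{n-1}^2}}{2}$. OGM-G stepsizes $\alpha_{i+1,j}$, $0\le j\le i\le n-1$ (for fixed $i$ defined for $j=i,i-1,\dots,0$): $$\alpha_{i+1,j}=\begin{cases}\frac{\theta_{n-j-1}-1}{\theta_{n-j}}\alpha_{i+1,j+1}&0\le j\le i-2,\\ \frac{\theta_{n-j-1}-1}{\theta_{n-j}}(\alpha_{i+1,i}-1)&j=i-1,\\ 1+\frac{2\theta_{n-i-1}-1}{\theta_{n-i}}&j=i.\end{cases}$$ Composite extension: from $x_0\in\mathbb{R}^d$, for $k=1,\dots,n$, $$x_k=x_{k-1}-\sum_{j=0}^{k-1}\alpha_{k,j}\big(\nabla f(x_j)+s_{j+1}\big),\qquad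 s_k\in\partial h(x_k);$$ equivalently $x_k=\mathrm{prox}_{\alpha_{k,k-1}h}\big(x_{k-1}-\sum_{j=0}^{k-2}\alpha_{k,j}(\nabla f(x_j)+s_{j+1})-\alpha_{k,k-1}\nabla f(x_{k-1})\big)$, with $s_k$ then determined by the displayed equation; $s_n$ in the claim is the one so generated. Here $\mathrm{prox}_{\alpha h}(x)=\arg\min_z\{\alpha h(z)+\frac12\|z-x\|^2\}$. $1$-smooth means differentiable with $1$-Lipschitz gradient. $a_n\sim b_n$ means $a_n/b_n\to1$. *)

(* Defs.v *)
From HB Require Import structures.
From mathcomp Require Import all_boot all_order all_algebra.
From mathcomp Require Import all_classical all_reals all_analysis.

Set Implicit Arguments.
Unset Strict Implicit.
Unset Printing Implicit Defensive.

Import Order.TTheory GRing.Theory Num.Theory.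
Import numFieldNormedType.Exports.

Local Open Scope classical_set_scope.
Local Open Scope ring_scope.

Section Stepsizes.
Variables (R : realType) (n : nat).

(* Only the values at indices 0..n are meaningful. *)
Fixpoint ogmg_theta (i : nat) : R :=
  if i is j.+1
  then (1 + Num.sqrt (1 + (if i == n then 8 else 4) * ogmg_theta j ^+ 2)) / 2
  else 1.

(* ogmg_alpha_rec i m is alpha_(i+1,i-m): the recursion, which descends in j
   from j = i, becomes structural in m = i - j. *)
Fixpoint ogmg_alpha_rec (i m : nat) : R :=
  match m with
  | 0 => 1 + (2 * ogmg_theta (n - i - 1) - 1) / ogmg_theta (n - i)
  | m'.+1 =>
      let j := (i - m)%N in
      (ogmg_theta (n - j - 1) - 1) / ogmg_theta (n - j)
        * (if m' is 0 then ogmg_alpha_rec i m' - 1 else ogmg_alpha_rec i m')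
  end.

(* alpha_(k,j), meaningful for j < k <= n *)
Definition ogmg_alpha (k j : nat) : R := ogmg_alpha_rec k.-1 (k.-1 - j).

Lemma ogmg_alpha_diag i :
  ogmg_alpha i.+1 i
    = 1 + (2 * ogmg_theta (n - i - 1) - 1) / ogmg_theta (n - i).
Proof. by rewrite /ogmg_alpha /= subnn. Qed.

Lemma ogmg_alpha_subdiag j :
  ogmg_alpha j.+2 j
    = (ogmg_theta (n - j - 1) - 1) / ogmg_theta (n - j)
        * (ogmg_alpha j.+2 j.+1 - 1).
Proof. by rewrite /ogmg_alpha /= subSnn subnn /= (subSS 0 j) subn0. Qed.

Lemma ogmg_alpha_lower i j : (j.+2 <= i)%N ->
  ogmg_alpha i.+1 j
    = (ogmg_theta (n - j - 1) - 1) / ogmg_theta (n - j)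
        * ogmg_alpha i.+1 j.+1.
Proof.
move=> ji; rewrite /ogmg_alpha /=; set m := (i - j.+2)%N.
have -> : i = (j + m.+2)%N by rewrite -(subnKC ji) -/m !addnS !addSn.
rewrite addKn -addSnnS addKn /=.
by rewrite addSnnS addnK.
Qed.

End Stepsizes.

Section ConvexComposite.
Variables (R : realType) (d : nat).
Implicit Types (f : 'rV[R]_d -> R) (h : 'rV[R]_d -> \bar R).

Definition dotv (u v : 'rV[R]_d) : R := \sum_(i < d) u 0 i * v 0 i.

(* The library norm `|u| on row vectors is the sup norm, hence a separate
   Euclidean norm; the two induce the same topology and differentiability. *)
Definition enorm (u : 'rV[R]_d) : R := Num.sqrt (dotv u u).

Definition gradient f (x : 'rV[R]_d) : 'rV[R]_d :=
  \row_(i < d) 'D_(delta_mx 0 i) f x.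

Definition smooth (L : R) f : Prop :=
  (forall x, differentiable f x) /\
  (forall x y, enorm (gradient f x - gradient f y) <= L * enorm (x - y)).

Definition proper_fun h : Prop :=
  (forall x, h x != -oo%E) /\ (exists x, (h x < +oo)%E).

Definition closed_fun h : Prop :=
  closed [set p : 'rV[R]_d * R | (h p.1 <= p.2%:E)%E].

(* Since 0 * +oo = 0 in \bar R, the cases t = 0 and t = 1 are harmless. *)
Definition econvex_fun h : Prop :=
  forall (t : R) (x y : 'rV[R]_d), 0 <= t -> t <= 1 ->
    (h (t *: x + (1 - t) *: y)%R
       <= t%:E * h x + (1 - t)%:E * h y)%E.

Definition subdifferential h (x : 'rV[R]_d) : set 'rV[R]_d :=
  [set s | forall y : 'rV[R]_d, (h x + (dotv s (y - x))%:E <= h y)%E].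

(* The value s 0 is unused. *)
Definition composite_ogmg (n : nat) f h (x s : nat -> 'rV[R]_d) : Prop :=
  forall k, (1 <= k <= n)%N ->
    x k = x k.-1
          - \sum_(j < k) ogmg_alpha R n k j *: (gradient f (x j) + s j.+1)
    /\ subdifferential h (x k) (s k).

End ConvexComposite.

(* Main.v *)
Require Import Defs.
From HB Require Import structures.
From mathcomp Require Import all_boot all_order all_algebra.
From mathcomp Require Import all_classical all_reals all_analysis.
From mathcomp Require Import ring lra zify.

Set Implicit Arguments.
Unset Strict Implicit.
Unset Printing Implicit Defensive.

Import Order.TTheory GRing.Theory Num.Theory.
Import numFieldNormedType.Exports.

Local Open Scope classical_set_scope.
Local Open Scope ring_scope.

(* Write t_i = theta_(n-i), v_j = grad f(x_j) + s_(j+1) for j < n,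
   v_n = grad f(x_n) + s_n, and z_i = sum_(j <= i) v_j / (t_(j+1)^2 t_j).
   Unrolling the stepsize recursion gives
     x_i - x_(i+1) = v_i + t_(i+1)^2 (2 t_(i+1) - 1) z_i,
     x_i - x_n     = v_i + t_(i+1)^4 z_i + sum_(i < l < n) t_l v_l.
   For f one adds the cocoercivity inequalities for the pairs (i, i+1) with
   weight 1/t_(i+1)^2 and (n, i) with weight 1/(t_(i+1)^2 t_i), which is the
   proof of the smooth case. Up to the Laplacian of these weights, the quadratic
   form so obtained is antisymmetric, and its negative transpose, applied to the
   subgradients s_(j+1), turns out to be a nonnegative combination of the
   subgradient inequalities of h whose function values telescope to the same
   multiple 2/t_0^2 of h(x_0) - h(x_n). The sum of both parts is
     (1 - 1/t_0^2) |v_n|^2 + sum_j <v_n, s_(j+1) - s_n> / (t_(j+1)^2 t_j)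
       + (squares of differences of the s_j weighted by the Laplacian),
   and completing squares leaves at least (1 - 1/(2 t_(n-1)^2)) |v_n|^2. The golden
   ratio t_(n-1) = theta_1 (here n >= 2 is used) produces the factor sqrt 5 - 1. *)

(** * Weights and the scalar certificate *)

Section OgmgCertificate.
Variables (R : realType) (n : nat) (t : nat -> R).
Hypothesis n_gt0 : (0 < n)%N.
Hypothesis t_ge1 : forall i, (i <= n)%N -> 1 <= t i.
Hypothesis tn : t n = 1.
Hypothesis tS : forall i, (0 < i < n)%N -> t i.+1 ^+ 2 = t i ^+ 2 - t i.
Hypothesis t0S : 2 * t 1%N ^+ 2 = t 0%N ^+ 2 - t 0%N.

Definition chainw i : R := (t i ^+ 2)^-1.
Definition starw i : R := (t i.+1 ^+ 2 * t i)^-1.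
Definition drift i : R := t i ^+ 2 * (2 * t i - 1).

Definition zsum (v : nat -> R) m : R := \sum_(j < m) starw j * v j.
Definition rsum (v : nat -> R) m : R := \sum_(m.+1 <= k < n) t k * v k.

(* x_i - x_n in terms of the directions v; see gapE. *)
Definition gap (v : nat -> R) i : R :=
  v i + t i.+1 ^+ 4 * zsum v i.+1 + rsum v i.

(* The coefficient of s_(j+1) that the multipliers of h have to cancel: row j of
   the transpose of the matrix of the f-part. Index n never contributes to x, so
   these lemmas are used with v_n = 0. *)
Definition dual (v : nat -> R) j : R :=
  chainw j.+1 * (v j.+1 - v j) + (j == 0)%:R * ((chainw 1 - starw 0) / 2 * v 0%N)
  + starw j * rsum v j - t j * zsum v j.

(** This and the next two linearity facts let the coordinatewise products of a subgradient with [v]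
    be subtracted from the profile of [h]. *)
Lemma zsum_lin (I : finType) (y : nat -> R) (c : I -> R) (v : I -> nat -> R) m :
  zsum (fun i => y i - \sum_a c a * v a i) m
  = zsum y m - \sum_a c a * zsum (v a) m.
Proof.
under [in RHS]eq_bigr do rewrite mulr_sumr.
rewrite exchange_big -sumrB; apply: eq_bigr => j _ /=.
by rewrite mulrBr mulr_sumr; congr (_ - _); apply: eq_bigr => a _; rewrite mulrCA.
Qed.

Lemma rsum_lin (I : finType) (y : nat -> R) (c : I -> R) (v : I -> nat -> R) m :
  rsum (fun i => y i - \sum_a c a * v a i) m
  = rsum y m - \sum_a c a * rsum (v a) m.
Proof.
under [in RHS]eq_bigr do rewrite mulr_sumr.
rewrite exchange_big -sumrB; apply: eq_bigr => j _ /=.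
by rewrite mulrBr mulr_sumr; congr (_ - _); apply: eq_bigr => a _; rewrite mulrCA.
Qed.

Lemma dual_lin (I : finType) (y : nat -> R) (c : I -> R) (v : I -> nat -> R) j :
  dual (fun i => y i - \sum_a c a * v a i) j
  = dual y j - \sum_a c a * dual (v a) j.
Proof.
have -> : \sum_a c a * dual (v a) j =
    chainw j.+1 * (\sum_a c a * v a j.+1 - \sum_a c a * v a j)
    + (j == 0)%:R * ((chainw 1 - starw 0) / 2 * \sum_a c a * v a 0%N)
    + starw j * (\sum_a c a * rsum (v a) j) - t j * (\sum_a c a * zsum (v a) j).
  rewrite -sumrB !mulr_sumr -!big_split -sumrB; apply: eq_bigr => a _ /=.
  by rewrite /dual; ring.
by rewrite /dual zsum_lin rsum_lin; ring.
Qed.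

(** * Signs and recursions of the weights *)

Lemma t_gt0 i : (i <= n)%N -> 0 < t i.
Proof. by move=> /t_ge1; apply: lt_le_trans. Qed.

Lemma t_neq0 i : (i <= n)%N -> t i != 0.
Proof. by move=> /t_gt0; rewrite lt0r => /andP[]. Qed.

Lemma t_dec i : (i < n)%N -> t i.+1 <= t i.
Proof.
move=> ltin; have ti := t_ge1 (ltnW ltin); have tSi := t_ge1 ltin.
rewrite -(@ler_pXn2r _ 2) ?nnegrE //; [|lra|lra].
case: i ltin ti tSi => [|i] ltin ti tSi; last by rewrite tS; [lra|].
by have := t0S; have := sqr_ge0 (t 1%N); lra.
Qed.

Lemma starw_gt0 i : (i < n)%N -> 0 < starw i.
Proof.
by move=> ltin; rewrite invr_gt0 mulr_gt0 ?exprn_gt0// t_gt0 // ltnW.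
Qed.

Lemma starw_neq0 i : (i < n)%N -> starw i != 0.
Proof. by move=> /starw_gt0; rewrite lt0r => /andP[]. Qed.

Lemma chainwS i : (i < n)%N -> chainw i.+1 = t i * starw i.
Proof.
move=> ltin; rewrite /chainw /starw; have := t_neq0 ltin; have := t_neq0 (ltnW ltin).
by move=> ? ?; field; apply/andP.
Qed.

(** The recursion gives [t i.+1 ^+ 2 = t i * (t i - 1)]. With [chainwS], consecutive chain weights
    differ by [starw i], which is the flow conservation of the multipliers of [f]; at index 0 the
    chain weight enters doubled. *)
Lemma chainw_pred i : (0 < i < n)%N -> chainw i = (t i - 1) * starw i.
Proof.
move=> /[dup] /andP[i0 ltin] /tS tSE; rewrite /chainw /starw.
have := t_neq0 ltin; have ti := t_neq0 (ltnW ltin).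
rewrite -sqrf_eq0 => tSi; rewrite [t i - 1](_ : _ = t i.+1 ^+ 2 / t i).
  by field; apply/andP; rewrite -(sqrf_eq0 (t i.+1)).
by rewrite tSE; field.
Qed.

Lemma chainw_n : chainw n = 1.
Proof. by rewrite /chainw tn expr1n invr1. Qed.

Lemma chainw0 : 2 * chainw 0 = (t 0%N - 1) * starw 0.
Proof.
have t0n := t_neq0 (leq0n n); have t1n := t_neq0 n_gt0.
rewrite /chainw /starw [t 0%N - 1](_ : _ = 2 * t 1%N ^+ 2 / t 0%N).
  by field; apply/andP.
by rewrite t0S; field.
Qed.

Lemma chainw_ge0 i : 0 <= chainw i.
Proof. by rewrite invr_ge0 exprn_even_ge0. Qed.

(** Leaves [t i] and [starw i] as the only atoms, so that [field] can check the telescoping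
    identities. *)
Lemma t4E i : (0 < i < n)%N -> t i.+1 ^+ 4 = (t i - 1) / starw i.
Proof.
move=> i0n; rewrite (_ : 4 = 2 * 2)%N // exprM /starw tS // invrK; ring.
Qed.

Lemma t4E0 : t 1 ^+ 4 = (t 0%N - 1) / (2 * starw 0).
Proof.
have t0n := t_neq0 (leq0n n); have t1n := t_neq0 n_gt0.
rewrite invfM /starw invrK mulrA.
have -> : (t 0%N - 1) / 2 * (t 1%N ^+ 2 * t 0%N) =
  t 1%N ^+ 2 * (t 0%N ^+ 2 - t 0%N) / 2 by ring.
by rewrite -t0S; field.
Qed.

Lemma driftE i : (i < n)%N -> drift i.+1 = (2 * t i.+1 - 1) / (t i * starw i).
Proof.
move=> ltin; rewrite -chainwS // /chainw /drift invrK; ring.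
Qed.

Lemma drift_t4 i : (i.+1 < n)%N -> drift i.+1 = t i.+1 ^+ 4 - t i.+2 ^+ 4.
Proof.
move=> ltin; rewrite (_ : 4 = 2 * 2)%N // !exprM /drift (tS (i := i.+1)) //; ring.
Qed.

Lemma drift_ge0 i : (i <= n)%N -> 0 <= drift i.
Proof.
by move=> /t_ge1 ti; rewrite mulr_ge0 ?sqr_ge0//; lra.
Qed.

(** * Partial sums and telescoping *)

Lemma zsumS v m : zsum v m.+1 = zsum v m + starw m * v m.
Proof. by rewrite /zsum big_ord_recr. Qed.

Lemma zsum0 v : zsum v 0 = 0.
Proof. exact: big_ord0. Qed.

Lemma rsumS v m : (m.+1 < n)%N -> rsum v m = t m.+1 * v m.+1 + rsum v m.+1.
Proof. by move=> ltmn; rewrite /rsum big_ltn. Qed.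

Lemma rsum_last v m : m.+1 = n -> rsum v m = 0.
Proof. by move=> mE; rewrite /rsum mE big_geq. Qed.

(** The newest summand of [zsum v i.+2] contributes [(t i.+1 - 1) * v i.+1]; with the leading
    [v i.+1] this cancels the first term of [rsum v i]. *)
Lemma gapS v i : (i.+1 < n)%N ->
  gap v i - gap v i.+1 = v i + drift i.+1 * zsum v i.+1.
Proof.
move=> ltin; rewrite drift_t4 // /gap (rsumS _ ltin) (zsumS _ i.+1) (t4E (i := i.+1)) //.
by field; exact: starw_neq0.
Qed.

Lemma gap_last v i : i.+1 = n -> gap v i = v i + drift i.+1 * zsum v i.+1.
Proof.
move=> iE; rewrite /gap rsum_last // /drift iE tn; ring.
Qed.

Lemma gapE (e y : nat -> R) i : (i < n)%N ->
  (forall k, (k < n)%N -> e k - e k.+1 = y k + drift k.+1 * zsum y k.+1) ->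
  gap y i = e i - e n.
Proof.
move=> ltin ey; have [m leiE] := ubnP (n - i); elim: m => // m IH in i ltin leiE *.
move: (ltin); rewrite leq_eqVlt => /predU1P[iE|ltSin].
  by rewrite gap_last// -ey// iE.
rewrite -[LHS](subrK (gap y i.+1)) gapS// -ey// IH ?subrKA//; lia.
Qed.

Lemma sum_starw m : (m < n)%N -> \sum_(i < m.+1) starw i = chainw m.+1 - 2 * chainw 0.
Proof.
elim: m => [|m IH] ltmn; rewrite big_ord_recr /=.
  by rewrite big_ord0 chainw0 chainwS //; ring.
by rewrite IH ?(ltnW ltmn)// [in RHS]chainwS // chainw_pred //; ring.
Qed.

(* The h-multipliers telescope: this is their flow conservation. *)
Lemma sum_dual (y : nat -> R) : y n = 0 ->
  \sum_(j < n) dual y j = - (2 * chainw 0) * gap y 0.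
Proof.
move=> yn0.
(* Closed form of the partial sums; at [m = n.-1] every term but the last vanishes. *)
have H m : (m < n)%N -> \sum_(j < m.+1) dual y j =
    chainw m.+1 * y m.+1 + (t m.+1 ^+ 2 - 1) * zsum y m.+1 + chainw m.+1 * rsum y m
    - 2 * chainw 0 * gap y 0.
  elim: m => [|m IH] ltmn; rewrite big_ord_recr /=.
    rewrite big_ord0 /dual /gap zsumS zsum0 eqxx mulr1n t4E0 chainw0 chainwS //.
    rewrite (_ : t 1 ^+ 2 = (t 0%N ^+ 2 - t 0%N) / 2); last by rewrite -t0S; field.
    by field; exact: starw_neq0.
  rewrite IH ?(ltnW ltmn)// /dual /=.
  rewrite [in RHS]tS // [in RHS]zsumS (rsumS _ ltmn) (chainwS (i := m.+1)) //.
  rewrite (chainw_pred (i := m.+1)) //; ring.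
have := H n.-1; rewrite prednK // leqnn => /(_ isT) ->.
by rewrite rsum_last ?prednK // yn0 tn; ring.
Qed.

(* Nonnegativity of the h-multipliers, without computing them: a function e that is
   nonnegative and vanishes at x_(j+1) cannot make the functional positive. It is
   applied to e_i = h(x_i) - h(x_(j+1)) - <s_(j+1), x_i - x_(j+1)>. *)
Lemma dual_le0 (e y : nat -> R) j : (j < n)%N -> y n = 0 ->
  (forall i, (i <= n)%N -> 0 <= e i) -> e j.+1 = 0 ->
  (forall i, (i < n)%N -> e i - e i.+1 = y i + drift i.+1 * zsum y i.+1) ->
  dual y j <= 0.
Proof.
move=> ltjn yn0 e_ge0 ej0 ey.
have ww_mono i : (i.+1 < n)%N -> starw i <= starw i.+1.
  move=> ltin; rewrite -[_ <= _]lef_pV2 ?posrE ?starw_gt0 ?(ltnW ltin)// /starw !invrK.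
  have t1 := t_dec ltin; have t2 := t_dec (ltnW ltin).
  have t3 := ltW (t_gt0 ltin); have t4 := ltW (t_gt0 (ltnW ltin)).
  by apply: ler_pM; rewrite ?exprn_ge0// ler_pXn2r// nnegrE.
(* The expression equals [zsum y i + starw i * e i]. If [zsum] is negative at the next index, the
   factor above 1 only helps, and [starw] increases, so nonnegativity propagates. *)
have zsum_ge i : (i <= j)%N ->
    0 <= (1 + starw i * drift i.+1) * zsum y i.+1 + starw i * e i.+1.
  elim: i => [|i IH] leij.
    have := ey 0%N n_gt0; rewrite zsumS zsum0 => ey0.
    have -> : (1 + starw 0 * drift 1) * (0 + starw 0 * y 0%N) + starw 0 * e 1%N
      = starw 0 * e 0%N by rewrite -[e 0%N](subrK (e 1%N)) ey0; ring.
    by rewrite mulr_ge0 ?e_ge0// ltW// starw_gt0.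
  have ltin : (i.+1 < n)%N by apply: leq_ltn_trans ltjn.
  have eyi := ey _ ltin.
  have -> : (1 + starw i.+1 * drift i.+2) * zsum y i.+2 + starw i.+1 * e i.+2
      = starw i.+1 * e i.+1 + zsum y i.+1.
    by rewrite -[e i.+1](subrK (e i.+2)) eyi zsumS; ring.
  have := IH (ltnW leij); have := ww_mono _ ltin.
  have := e_ge0 i.+1 (ltnW ltin).
  have : 0 <= starw i * drift i.+1.
    by rewrite mulr_ge0 ?drift_ge0 ?(ltnW ltin)// ltW// starw_gt0// ltnW.
  set q := starw i * drift i.+1; set z := zsum y i.+1; set E := e i.+1.
  move=> q0 E0 wle zge.
  have wE : starw i * E <= starw i.+1 * E by rewrite ler_wpM2r.
  have [z0|z0] := leP 0 z.
    by rewrite addr_ge0// mulr_ge0// ltW// starw_gt0.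
  have : q * z <= 0 by rewrite mulr_ge0_le0// ltW.
  by lra.
have z_ge0 : 0 <= zsum y j.+1.
  have := zsum_ge j (leqnn j); rewrite ej0 mulr0 addr0 pmulr_rge0//.
  by rewrite ltr_pwDl// mulr_ge0 ?drift_ge0// ltW// starw_gt0.
(* Absorbing [y j] into [zsum y j.+1] leaves three summands whose signs are settled separately. *)
have dualE : dual y j = chainw j.+1 * y j.+1 + starw j * rsum y j
    - (if j == 0%N then (t 0%N + 1) / 2 else t j) * zsum y j.+1.
  rewrite /dual chainwS// zsumS; case: eqVneq => [->|j0] /=; last by ring.
  by rewrite zsum0 chainwS//; field.
have coef_ge0 : 0 <= (if j == 0%N then (t 0%N + 1) / 2 else t j).
  have t0 := t_ge1 (leq0n n); have tj := t_gt0 (ltnW ltjn).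
  by case: ifP => _; lra.
rewrite dualE; move: ltjn; rewrite leq_eqVlt => /predU1P[jn|ltjn].
  have -> : y j.+1 = 0 by rewrite jn.
  by rewrite rsum_last// !mulr0 !add0r oppr_le0 mulr_ge0.
have y_le0 : y j.+1 <= 0.
  have := ey _ ltjn; have := e_ge0 _ ltjn; rewrite ej0 (zsumS _ j.+1).
  have := drift_ge0 ltjn; have := starw_gt0 ltjn => w0 c0 e0 eE.
  have cz : 0 <= drift j.+2 * zsum y j.+1 by rewrite mulr_ge0.
  have cw0 : 0 <= drift j.+2 * starw j.+1 by rewrite mulr_ge0// ltW.
  by rewrite leNgt; apply/negP => y0; have := mulr_ge0 cw0 (ltW y0); lra.
have rsumE : rsum y j = - e n - t j.+2 ^+ 4 * zsum y j.+1.
  have := gapE ltjn ey; rewrite ej0 add0r => <-.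
  rewrite /gap (rsumS _ ltjn) (zsumS _ j.+1) (t4E (i := j.+1))//.
  by field; exact: starw_neq0.
have wj := ltW (starw_gt0 (ltnW ltjn)).
have : 0 <= starw j * e n by rewrite mulr_ge0 ?e_ge0.
have : 0 <= starw j * (t j.+2 ^+ 4 * zsum y j.+1).
  by apply: mulr_ge0 => //; apply: mulr_ge0 => //; rewrite exprn_even_ge0.
have : chainw j.+1 * y j.+1 <= 0 by rewrite mulr_ge0_le0 ?chainw_ge0.
have := mulr_ge0 coef_ge0 z_ge0.
by rewrite rsumE; lra.
Qed.

(* The cross terms telescope through the product z_i * sum_(i < l < n) t_l v_l. *)
Lemma quad_identity (g s v : nat -> R) :
  (forall i, (i < n)%N -> v i = g i + s i) -> v n = 0 -> s n.-1 = s n ->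
  \sum_(i < n)
    (chainw i.+1 * (g i.+1 * (v i + drift i.+1 * zsum v i.+1) + (g i - g i.+1) ^+ 2 / 2)
     + starw i * ((g n - g i) ^+ 2 / 2 - g i * gap v i) - s i * dual v i)
  = (1 - chainw 0) * (g n + s n) ^+ 2
    + \sum_(i < n) (starw i * ((g n + s n) * (s i - s n) + (s i - s n) ^+ 2 / 2)
                    + chainw i.+1 * ((s i - s i.+1) ^+ 2 / 2)).
Proof.
move=> vE vn0 sn; apply/eqP; rewrite -subr_eq -sumrB; apply/eqP.
pose T i :=
  (chainw i.+1 * (g i.+1 * (v i + drift i.+1 * zsum v i.+1) + (g i - g i.+1) ^+ 2 / 2)
   + starw i * ((g n - g i) ^+ 2 / 2 - g i * gap v i) - s i * dual v i)
  - (starw i * ((g n + s n) * (s i - s n) + (s i - s n) ^+ 2 / 2)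
     + chainw i.+1 * ((s i - s i.+1) ^+ 2 / 2)).
transitivity (\sum_(i < n) T i) => //.
have H m : (m < n)%N -> \sum_(i < m.+1) T i =
    chainw m.+1 * ((g m.+1 ^+ 2 - s m.+1 ^+ 2) / 2 + s m * (g m.+1 + s m.+1 - v m.+1))
    + (2 * t m.+1 - 1) * g m.+1 * zsum v m.+1 - zsum v m.+1 * rsum v m
    - g n * zsum v m.+1 + (chainw m.+1 - 2 * chainw 0) * (g n + s n) ^+ 2 / 2.
  elim: m => [|m IH] ltmn; rewrite big_ord_recr /=.
    rewrite big_ord0 /T /dual /gap zsumS zsum0 eqxx mulr1n t4E0 driftE//.
    rewrite chainw0 chainwS//.
    by rewrite vE//; field; rewrite starw_neq0// t_neq0//.
  rewrite IH ?(ltnW ltmn)// /T /dual /gap /= t4E// driftE// (zsumS _ m.+1) (rsumS _ ltmn).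
  rewrite (chainwS ltmn) (chainw_pred (i := m.+1))// (vE _ ltmn).
  by field; rewrite starw_neq0// t_neq0// ltnW.
have := H n.-1; rewrite prednK // leqnn => /(_ isT) ->.
by rewrite rsum_last ?prednK // vn0 tn sn chainw_n; field.
Qed.

(* s is shifted with respect to the subgradients: s_i stands for s_(i+1) when i < n,
   and s_n occurs twice, whence the last hypothesis. *)
Lemma quad_lower_bound (g s v : nat -> R) : (1 < n)%N ->
  (forall i, (i < n)%N -> v i = g i + s i) -> v n = 0 -> s n.-1 = s n ->
  (1 - chainw n.-1 / 2) * (g n + s n) ^+ 2 <=
  \sum_(i < n)
    (chainw i.+1 * (g i.+1 * (v i + drift i.+1 * zsum v i.+1) + (g i - g i.+1) ^+ 2 / 2)
     + starw i * ((g n - g i) ^+ 2 / 2 - g i * gap v i) - s i * dual v i).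
Proof.
move=> n_gt1 vE vn0 sn; rewrite quad_identity//; set V := g n + s n.
pose F i := starw i * (V * (s i - s n) + (s i - s n) ^+ 2 / 2)
            + chainw i.+1 * ((s i - s i.+1) ^+ 2 / 2).
(* The added term completes the square of [V + (s i - s n)]. *)
have F_ge i : (i < n)%N -> 0 <= F i + starw i * (V ^+ 2 / 2).
  move=> ltin; rewrite /F addrAC -mulrDr.
  have -> : V * (s i - s n) + (s i - s n) ^+ 2 / 2 + V ^+ 2 / 2
    = (V + (s i - s n)) ^+ 2 / 2 by field.
  have := starw_gt0 ltin; have := chainw_ge0 i.+1 => p0 w0.
  by rewrite addr_ge0// mulr_ge0 ?divr_ge0 ?sqr_ge0// ltW.
have ltpn : (n.-1 < n)%N by rewrite prednK.
(* Only the last summand is kept: there [F] vanishes because [s n.-1 = s n]. This raises the final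
   coefficient from 1/2 to [1 - chainw n.-1 / 2]. *)
have : starw n.-1 * (V ^+ 2 / 2) <= \sum_(i < n) (F i + starw i * (V ^+ 2 / 2)).
  have F0 : F n.-1 = 0 by rewrite /F prednK// sn; field.
  rewrite (bigD1 (Ordinal ltpn))//= F0 add0r lerDl sumr_ge0// => i _.
  exact: F_ge.
have wE := sum_starw ltpn; rewrite prednK// in wE.
have pE : chainw n.-1 = 1 - starw n.-1.
  have := chainwS ltpn; rewrite prednK// chainw_n => tw.
  by rewrite chainw_pred ?mulrBl -?tw ?mul1r// ltpn -subn1 subn_gt0 n_gt1.
by rewrite big_split /= -mulr_suml wE chainw_n pE => H; rewrite /F in H; lra.
Qed.

(* Extends the function values of h along the iterates to a sequence obeying the
   same linear relations as the coordinates of the iterates. *)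
Lemma increment_profile (e : nat -> R) : exists2 y : nat -> R, y n = 0 &
  forall i, (i < n)%N -> e i - e i.+1 = y i + drift i.+1 * zsum y i.+1.
Proof.
(* [Z] is the future [zsum y]: substituting [y i = (Z i.+1 - Z i) / starw i] makes the implicit
   relation explicit in [Z i.+1]. *)
have [Z [Z0 ZS]] : exists Z : nat -> R, Z 0%N = 0 /\ forall i,
    Z i.+1 = (Z i + starw i * (e i - e i.+1)) / (1 + starw i * drift i.+1).
  by exists (fix Z m := if m is i.+1
    then (Z i + starw i * (e i - e i.+1)) / (1 + starw i * drift i.+1) else 0).
pose y i : R := if (i < n)%N then (Z i.+1 - Z i) / starw i else 0.
have ZE m : (m <= n)%N -> zsum y m = Z m.
  elim: m => [|m IH] lemn; first by rewrite zsum0 Z0.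
  rewrite zsumS IH ?ltW// /y ?lemn; last exact: ltnW.
  by field; exact: starw_neq0.
exists y => [|i ltin]; first by rewrite /y ltnn.
rewrite ZE// /y ltin ZS.
have w0 := starw_gt0 ltin; have c0 := drift_ge0 ltin.
have wc0 : 0 < 1 + starw i * drift i.+1 by rewrite ltr_pwDl// mulr_ge0// ltW.
by field; rewrite !gt_eqF.
Qed.

(** The quadratic bound holds in each coordinate; only the inequalities for [phi] and [eta] couple
    coordinates, so they are used after summation. *)
Lemma certificate d (x g s : nat -> 'rV[R]_d) (phi eta : nat -> R) : (1 < n)%N ->
  let v j := g j + s j.+1 in
  (forall i, (i < n)%N ->
     x i - x i.+1 = v i + drift i.+1 *: \sum_(j < i.+1) starw j *: v j) ->
  (forall i j, (i <= n)%N -> (j <= n)%N ->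
     dotv (g j) (x i - x j) + dotv (g i - g j) (g i - g j) / 2 <= phi i - phi j) ->
  (forall i j, (i <= n)%N -> (0 < j <= n)%N ->
     dotv (s j) (x i - x j) <= eta i - eta j) ->
  (1 - chainw n.-1 / 2) * dotv (g n + s n) (g n + s n) <=
  2 * chainw 0 * (phi 0%N + eta 0%N - (phi n + eta n)).
Proof.
move=> n_gt1 v xE phiP etaP.
have vE a j : v j 0 a = g j 0 a + s j.+1 0 a by rewrite mxE.
clearbody v.
pose vc (a : 'I_d) i : R := if (i < n)%N then v i 0 a else 0.
pose sc (a : 'I_d) i : R := if (i < n)%N then s i.+1 0 a else s n 0 a.
have zsumE a i : (i <= n)%N ->
    zsum (vc a) i = (\sum_(j < i) starw j *: v j) 0 a.
  move=> lein; rewrite summxE; apply: eq_bigr => j _.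
  by rewrite mxE /vc (leq_trans (ltn_ord j)).
have xEa a i : (i < n)%N ->
    x i 0 a - x i.+1 0 a = vc a i + drift i.+1 * zsum (vc a) i.+1.
  move=> ltin; have := congr1 (fun u : 'rV_d => u 0 a) (xE i ltin).
  by rewrite !mxE => ->; rewrite zsumE// /vc ltin.
have vcn a : vc a n = 0 by rewrite /vc ltnn.
have gapx a i : (i < n)%N -> gap (vc a) i = x i 0 a - x n 0 a.
  by move=> ltin; apply: (gapE (e := fun k => x k 0 a)) => // k; apply: xEa.
have phi_sum : \sum_(i < n) (chainw i.+1 * (phi i - phi i.+1) + starw i * (phi n - phi i))
    = 2 * chainw 0 * (phi 0%N - phi n).
  have H m : (m < n)%N ->
      \sum_(i < m.+1) (chainw i.+1 * (phi i - phi i.+1) + starw i * (phi n - phi i))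
      = 2 * chainw 0 * (phi 0%N - phi n) - chainw m.+1 * (phi m.+1 - phi n).
    elim: m => [|m IH] ltmn; rewrite big_ord_recr /=.
      by rewrite big_ord0 chainw0 chainwS//; ring.
    by rewrite IH ?(ltnW ltmn)// (chainw_pred (i := m.+1))// (chainwS ltmn); ring.
  have := H n.-1; rewrite prednK // leqnn => /(_ isT) ->.
  by rewrite subrr mulr0 subr0.
have [y yn0 etaE] := increment_profile eta.
(* By linearity each [j] compares [dual y j] with its subgradient part through [dual_le0]; summing
   over [j], [sum_dual] evaluates the former. *)
have eta_sum : \sum_(j < n) \sum_(a < d) - (s j.+1 0 a * dual (vc a) j)
    <= 2 * chainw 0 * (eta 0%N - eta n).
  rewrite -(gapE n_gt0 etaE) -[_ * gap y 0]opprK -mulNr -(sum_dual yn0) -sumrN.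
  apply: ler_sum => j _; rewrite sumrN lerN2.
  have lejn := ltn_ord j.
  pose e i := eta i - eta j.+1 - dotv (s j.+1) (x i - x j.+1).
  rewrite -subr_le0 -dual_lin; apply: (dual_le0 (e := e)) => //.
  - by rewrite yn0 big1 ?subr0// => a _; rewrite vcn mulr0.
  - by move=> i lein; rewrite /e subr_ge0 etaP.
  - by rewrite /e !subrr /dotv big1 ?subr0// => a _; rewrite mxE mulr0.
  - move=> i ltin; rewrite zsum_lin.
    have -> : e i - e i.+1
        = eta i - eta i.+1 - dotv (s j.+1) (x i - x i.+1).
      rewrite /e [dotv _ (x i - x j.+1)](_ : _ = dotv (s j.+1) (x i - x i.+1)
        + dotv (s j.+1) (x i.+1 - x j.+1)); first by ring.
      by rewrite -big_split; apply: eq_bigr => a _ /=; rewrite !mxE; ring.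
    rewrite etaE//.
    rewrite [dotv _ _](_ : _ = \sum_(a < d) s j.+1 0 a * vc a i
        + drift i.+1 * \sum_a s j.+1 0 a * zsum (vc a) i.+1); first by ring.
    rewrite mulr_sumr -big_split; apply: eq_bigr => a _ /=.
    by have := xEa a i ltin; rewrite !mxE => ->; ring.
have key a : (1 - chainw n.-1 / 2) * (g n + s n) 0 a ^+ 2 <=
  \sum_(i < n)
    (chainw i.+1 * (g i.+1 0 a * (x i - x i.+1) 0 a + (g i - g i.+1) 0 a ^+ 2 / 2)
     + starw i * ((g n - g i) 0 a ^+ 2 / 2 + g i 0 a * (x n - x i) 0 a)
     - s i.+1 0 a * dual (vc a) i).
  have := @quad_lower_bound (fun i => g i 0 a) (sc a) (vc a) n_gt1 _ (vcn a).
  rewrite /sc ltnn prednK// leqnn mxE => H; apply: le_trans (H _ _) _ => //.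
    by move=> i ltin; rewrite /vc ltin vE.
  apply: ler_sum => i _; rewrite !mxE ltn_ord gapx// xEa//.
  by rewrite le_eqVlt; apply/orP; left; apply/eqP; ring.
rewrite mulr_sumr; apply: le_trans (ler_sum _ (fun a _ => key a)) _.
rewrite exchange_big /=.
have -> : 2 * chainw 0 * (phi 0%N + eta 0%N - (phi n + eta n))
  = 2 * chainw 0 * (phi 0%N - phi n) + 2 * chainw 0 * (eta 0%N - eta n) by ring.
apply: le_trans (lerD (lexx _) eta_sum); rewrite -phi_sum -big_split /=.
apply: ler_sum => i _; have ltin := ltn_ord i.
have -> : \sum_(a < d) (chainw i.+1 * (g i.+1 0 a * (x i - x i.+1) 0 a
      + (g i - g i.+1) 0 a ^+ 2 / 2)
    + starw i * ((g n - g i) 0 a ^+ 2 / 2 + g i 0 a * (x n - x i) 0 a)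
    - s i.+1 0 a * dual (vc a) i)
  = chainw i.+1 * (dotv (g i.+1) (x i - x i.+1)
      + dotv (g i - g i.+1) (g i - g i.+1) / 2)
    + starw i * (dotv (g i) (x n - x i) + dotv (g n - g i) (g n - g i) / 2)
    + \sum_(a < d) - (s i.+1 0 a * dual (vc a) i).
  rewrite /dotv !mulr_suml -!big_split !mulr_sumr -!big_split.
  by apply: eq_bigr => a _ /=; rewrite -!expr2; ring.
rewrite lerD2r lerD// ler_wpM2l ?chainw_ge0//; first exact/phiP/ltin/ltnW.
  exact/ltW/starw_gt0.
by apply: phiP => //; exact: ltnW.
Qed.

End OgmgCertificate.

(** * Smooth convex functions *)

Section SmoothConvex.
Variables (R : realType) (d : nat).
Implicit Types (f : 'rV[R]_d -> R) (x y u v : 'rV[R]_d).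

Lemma dotv_ge0 u : 0 <= dotv u u.
Proof. by rewrite sumr_ge0// => i _; rewrite -expr2 sqr_ge0. Qed.

Lemma enorm_sq u : enorm u ^+ 2 = dotv u u.
Proof. exact/sqr_sqrtr/dotv_ge0. Qed.

Lemma derive_gradient f x v : differentiable f x ->
  'D_v f x = dotv (gradient f x) v.
Proof.
move=> df; rewrite deriveE// [in LHS](row_sum_delta v) linear_sum.
apply: eq_bigr => i _; rewrite linearZ /= !mxE deriveE//.
exact: mulrC.
Qed.

Lemma line_quotient f x v (s : R) :
  (fun h : R => h^-1 *: (f (x + (h *: 1 + s) *: v) - f (x + s *: v)))
  = (fun h : R => h^-1 *: (f (h *: v + (x + s *: v)) - f (x + s *: v))).
Proof.
apply/funext => h; congr (_ *: (f _ - _)).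
by rewrite [h *: 1]mulr1 scalerDl addrCA.
Qed.

Lemma is_derive_line f x v (s : R) : differentiable f (x + s *: v) ->
  is_derive s 1 (fun r : R => f (x + r *: v)) (dotv (gradient f (x + s *: v)) v).
Proof.
move=> df; apply: DeriveDef.
  by rewrite /derivable line_quotient; exact: diff_derivable.
by rewrite -derive_gradient// /derive line_quotient.
Qed.

(** Convexity bounds the difference quotients for steps in (0, 1]; let the step tend to 0 from the
    right. *)
Lemma convex_gradient_le f x y : convex_function setT f -> differentiable f x ->
  dotv (gradient f x) (y - x) <= f y - f x.
Proof.
move=> cf df; rewrite -derive_gradient//; set v := y - x.
have H : h^-1 *: (f (h *: v + x) - f x) @[h --> 0^'+] --> 'D_v f x.
  apply: cvg_dnbhs_at_right; exact: diff_derivable.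
rewrite -(cvg_lim _ H)//; apply: limr_le; first by apply/cvg_ex; eexists; exact: H.
near=> h.
have h0 : 0 < h by [].
have h1 : h <= 1 by near: h; exact: nbhs_right_le.
rewrite -[_ *: _]/(h^-1 * _) ler_pdivrMl//.
have : f (h *: y + (1 - h) *: x) <= h * f y + (1 - h) * f x.
  by have := cf (Itv01 (ltW h0) h1) y x; rewrite !in_setT => /(_ isT isT).
have -> : h *: y + (1 - h) *: x = h *: v + x.
  by rewrite /v scalerBl scale1r scalerBr [RHS]addrAC addrA.
by move=> ?; lra.
Unshelve. all: by end_near.
Qed.

Lemma dotvDl u v y : dotv (u + v) y = dotv u y + dotv v y.
Proof. by rewrite -big_split; apply: eq_bigr => i _ /=; rewrite mxE mulrDl. Qed.

Lemma dotvNl u y : dotv (- u) y = - dotv u y.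
Proof. by rewrite -sumrN; apply: eq_bigr => i _ /=; rewrite mxE mulNr. Qed.

Lemma dotvZl (a : R) u y : dotv (a *: u) y = a * dotv u y.
Proof. by rewrite mulr_sumr; apply: eq_bigr => i _ /=; rewrite mxE mulrA. Qed.

Lemma dotvC u v : dotv u v = dotv v u.
Proof. by apply: eq_bigr => i _; rewrite mulrC. Qed.

Lemma dotvBB u v : dotv (u - v) (u - v) = dotv u u - 2 * dotv u v + dotv v v.
Proof.
rewrite dotvDl dotvNl !(dotvC _ (u - v)) !dotvDl !dotvNl (dotvC v u); ring.
Qed.

(** Expanding the squared norm of [w - s *: v] replaces Cauchy-Schwarz. *)
Lemma smooth_dotv_le f x v (s : R) : smooth 1 f -> 0 < s ->
  dotv (gradient f (x + s *: v) - gradient f x) v <= s * dotv v v.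
Proof.
move=> [_ lf] s0; set w := _ - _.
have ww : dotv w w <= s ^+ 2 * dotv v v.
  rewrite -!enorm_sq -exprMn lerXn2r ?nnegrE ?mulr_ge0 ?sqrtr_ge0 ?(ltW s0)//.
  apply: le_trans (lf _ _) _; rewrite mul1r addrC addKr /enorm dotvZl dotvC dotvZl.
  by rewrite mulrA -expr2 sqrtrM ?sqr_ge0// sqrtr_sqr gtr0_norm.
have : 0 <= dotv (w - s *: v) (w - s *: v) by exact: dotv_ge0.
rewrite dotvBB (dotvC w (s *: v)) !dotvZl (dotvC v (s *: v)) dotvZl (dotvC v w) => H.
by rewrite -(ler_pM2l s0); lra.
Qed.

(** Along the segment, [f] minus its quadratic model has nonpositive derivative. *)
Lemma descent f x v : smooth 1 f ->
  f (x + v) <= f x + dotv (gradient f x) v + dotv v v / 2.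
Proof.
move=> sf; have df := sf.1.
pose psi (s : R) := f (x + s *: v)
  - (s * dotv (gradient f x) v + s ^+ 2 * (dotv v v / 2)).
have dpsi (s : R) : is_derive s 1 psi (dotv (gradient f (x + s *: v)) v
    - (dotv (gradient f x) v + s * dotv v v)).
  have dl := is_derive_line (df (x + s *: v)).
  have -> : psi = (fun r : R => f (x + r *: v)) - dotv (gradient f x) v \*: (@id R)
      - (dotv v v / 2) \*: ((@id R) ^+ 2).
    apply/funext => r; rewrite /psi.
    set a := dotv _ v; set b := dotv v v / 2; set F := f _.
    have E : F - (r * a + r ^+ 2 * b) = F - a * r - b * r ^+ 2 by ring.
    exact: E.
  apply: is_derive_eq; set A := dotv _ v; set a := dotv _ v; set b := dotv v v.
  have E : A - a * 1 - b / 2 * (2 * s ^+ 1 * 1) = A - (a + s * b) by field.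
  exact: E.
have : psi 1 <= psi 0.
  apply: (@ler0_derive1_le_cc _ psi 0 1).
  - by move=> s _; case: (dpsi s).
  - move=> s; rewrite in_itv/= => /andP[s0 _]; rewrite derive1E.
    rewrite (@derive_val _ _ _ _ _ _ _ (dpsi s)).
    by have := smooth_dotv_le x v sf s0; rewrite dotvDl dotvNl; lra.
  - apply: continuous_subspaceT => s; apply: differentiable_continuous.
    by apply/derivable1_diffP; case: (dpsi s).
  - by rewrite in_itv/= lexx ler01.
  - by rewrite in_itv/= lexx ler01.
  - exact: ler01.
by rewrite /psi scale1r scale0r addr0 expr1n expr0n/= !mul0r !mul1r; lra.
Qed.

(** Compare at [x - w], a unit gradient step of [f] minus its linearization at [y]: descent from [x]
    bounds [f] above, convexity at [y] below. *)
Lemma cocoercive f x y : convex_function setT f -> smooth 1 f ->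
  dotv (gradient f y) (x - y)
    + dotv (gradient f x - gradient f y) (gradient f x - gradient f y) / 2
  <= f x - f y.
Proof.
move=> cf sf; set w := gradient f x - gradient f y.
have := descent x (- w) sf; have := convex_gradient_le (x - w) cf (sf.1 y).
have -> : dotv (gradient f y) (x - w - y)
    = dotv (gradient f y) (x - y) - dotv (gradient f y) w.
  by rewrite addrAC dotvC dotvDl dotvNl !(dotvC _ (gradient f y)).
have -> : dotv (gradient f x) (- w) = - dotv (gradient f x) w.
  by rewrite dotvC dotvNl dotvC.
have -> : dotv (- w) (- w) = dotv w w by rewrite dotvNl dotvC dotvNl opprK.
have -> : dotv w w = dotv (gradient f x) w - dotv (gradient f y) w.
  by rewrite -dotvNl -dotvDl.
lra.
Qed.
End SmoothConvex.

(** * The OGM-G stepsizes *)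

Section Stepsizes.
Variable R : realType.
Implicit Types (n i j k m : nat).

Lemma theta_rec n i : let th := ogmg_theta R n in
  th i.+1 ^+ 2 - th i.+1 = (if i.+1 == n then 2 else 1) * th i ^+ 2.
Proof.
move=> th; have : 0 <= 1 + (if i.+1 == n then 8 else 4) * th i ^+ 2.
  by rewrite addr_ge0// mulr_ge0 ?sqr_ge0//; case: ifP.
rewrite /th [ogmg_theta R n i.+1]/= => /sqr_sqrtr; case: ifP => _.
  by set q := Num.sqrt _ => qE; field: qE.
by set q := Num.sqrt _ => qE; field: qE.
Qed.

Lemma theta_ge1 n i : 1 <= ogmg_theta R n i.
Proof.
elim: i => //= i IH; set C := (if _ then 8 else 4).
have C0 : 0 <= C by rewrite /C; case: ifP.
suff : 1 <= Num.sqrt (1 + C * ogmg_theta R n i ^+ 2) by lra.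
by rewrite -[leLHS]sqrtr1 ler_wsqrtr// lerDl mulr_ge0// sqr_ge0.
Qed.

(** For parameter 0 the last-step test never succeeds, so [ogmg_theta R 0] is the unmodified
    sequence. *)
Lemma theta_std n i : (i < n)%N -> ogmg_theta R n i = ogmg_theta R 0 i.
Proof.
elim: i => //= i IH ltin; rewrite IH ?(ltnW ltin)//.
by rewrite [_ == n]ltn_eqF.
Qed.

Definition theta_rev n i : R := ogmg_theta R n (n - i).

Lemma theta_rev_ge1 n i : (i <= n)%N -> 1 <= theta_rev n i.
Proof. by move=> _; exact: theta_ge1. Qed.

Lemma theta_rev_n n : theta_rev n n = 1.
Proof. by rewrite /theta_rev subnn. Qed.

Lemma theta_rev_S n i : (0 < i < n)%N ->
  theta_rev n i.+1 ^+ 2 = theta_rev n i ^+ 2 - theta_rev n i.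
Proof.
move=> /andP[i0 ltin]; rewrite /theta_rev -(subnSK ltin) theta_rec ifF ?mul1r//.
by apply/negbTE; rewrite subnSK//; lia.
Qed.

Lemma theta_rev_0 n : (0 < n)%N ->
  2 * theta_rev n 1 ^+ 2 = theta_rev n 0 ^+ 2 - theta_rev n 0.
Proof.
by case: n => // n _; rewrite /theta_rev subSS !subn0 theta_rec eqxx.
Qed.

(** Identity plus rank one: the factors of the recursion telescope into [starw], and the subtracted
    1 below the diagonal removes the identity part. *)
Lemma alphaE n i j : (j <= i)%N -> (i < n)%N -> ogmg_alpha R n i.+1 j
  = (i == j)%:R + drift (theta_rev n) i.+1 * starw (theta_rev n) j.
Proof.
move=> leji ltin; rewrite -(subKn leji); have := leq_subr j i.
have n0 : (0 < n)%N by apply: leq_ltn_trans ltin.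
have tn0 k : (k <= n)%N -> theta_rev n k != 0.
  by move/theta_rev_ge1; apply: contraTneq => ->; rewrite ler10.
elim: (i - j)%N => [|m IH] lemi.
  rewrite subn0 eqxx mulr1n ogmg_alpha_diag /drift /starw -subnDA addn1.
  rewrite -/(theta_rev n i.+1) -/(theta_rev n i).
  by field; rewrite !tn0// ltnW.
have -> : (i == i - m.+1)%N = false by lia.
rewrite mulr0n add0r.
have step : ((ogmg_theta R n (n - (i - m.+1) - 1) - 1)
      / ogmg_theta R n (n - (i - m.+1))) * starw (theta_rev n) (i - m)
    = starw (theta_rev n) (i - m.+1).
  have jE : (i - m = (i - m.+1).+1)%N by lia.
  have := chainw_pred (@theta_rev_ge1 n) (@theta_rev_S n) (i := i - m).
  have := chainwS (@theta_rev_ge1 n) (i := i - m.+1).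
  rewrite -subnDA addn1 jE => -> /=; last by lia.
  move=> /(_ ltac:(lia)).
  rewrite -/(theta_rev n (i - m.+1).+1) -/(theta_rev n (i - m.+1)) => wE.
  by rewrite mulrAC -wE; field; apply: tn0; lia.
rewrite -step mulrCA; case: m IH lemi {step} => [|m] IH lemi.
  have iE : (i - 1).+1 = i by lia.
  have := ogmg_alpha_subdiag R n (i - 1); rewrite iE => ->.
  have := IH isT; rewrite !subn0 eqxx => ->; congr (_ * _).
  by rewrite mulr1n addrC addKr.
rewrite ogmg_alpha_lower; last by lia.
have -> : (i - m.+2).+1 = (i - m.+1)%N by lia.
rewrite IH ?(ltnW lemi)//.
have -> : (i == i - m.+1)%N = false by lia.
by rewrite add0r.
Qed.

End Stepsizes.

(** * Rate and asymptotics *)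

Section Rate.
Variable R : realType.

(** As [1 < n], index 1 is not the modified last one, whence the golden ratio. *)
Lemma theta_rev_pred n : (1 < n)%N -> theta_rev R n n.-1 = (1 + Num.sqrt 5) / 2.
Proof.
move=> n1; rewrite /theta_rev (_ : n - n.-1 = 1)%N; last by lia.
by rewrite /= ltn_eqF// expr1n mulr1 (_ : 1 + 4 = 5)// -natr1; ring.
Qed.

Lemma ogmg_rate (d n : nat) (x g s : nat -> 'rV[R]_d) (phi eta : nat -> R) :
  (1 < n)%N ->
  (forall i, (i < n)%N -> x i.+1 =
     x i - \sum_(j < i.+1) ogmg_alpha R n i.+1 j *: (g j + s j.+1)) ->
  (forall i j, (i <= n)%N -> (j <= n)%N ->
     dotv (g j) (x i - x j) + dotv (g i - g j) (g i - g j) / 2 <= phi i - phi j) ->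
  (forall i j, (i <= n)%N -> (0 < j <= n)%N ->
     dotv (s j) (x i - x j) <= eta i - eta j) ->
  dotv (g n + s n) (g n + s n) <=
  2 * (Num.sqrt 5 - 1) / ogmg_theta R n n ^+ 2
    * (phi 0%N + eta 0%N - (phi n + eta n)).
Proof.
move=> n1 xE phiP etaP; have n0 := ltnW n1.
have := certificate n0 (@theta_rev_ge1 R n) (@theta_rev_n R n) (@theta_rev_S R n)
  (theta_rev_0 R n0) n1 _ phiP etaP.
have t0E : theta_rev R n 0 = ogmg_theta R n n by rewrite /theta_rev subn0.
rewrite /chainw theta_rev_pred// t0E => H.
have {}H := H _.
set q : R := Num.sqrt 5; set D := _ - (_ + _).
have q2 : q ^+ 2 = 5 by rewrite sqr_sqrtr.
have q1 : 0 < q - 1.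
  by rewrite subr_gt0 -[ltLHS]sqrtr1 ltr_sqrt// ltr1n.
(* Turns the coefficient of the certificate into the factor [q - 1] of the rate. *)
have qE : (1 - ((1 + q) / 2) ^- 2 / 2) = (q - 1)^-1.
  have q1n : 1 + q != 0 by rewrite gt_eqF//; lra.
  have q1n' : q - 1 != 0 by rewrite gt_eqF.
  by field: q2; rewrite q1n q1n'.
have {H} : (1 - ((1 + q) / 2) ^- 2 / 2) * dotv (g n + s n) (g n + s n)
    <= 2 * (ogmg_theta R n n ^+ 2)^-1 * D.
  apply: H => i ltin; rewrite xE// opprB addrC subrK.
  transitivity (\sum_(j < i.+1) ((i == j)%:R *: (g j + s j.+1)
      + drift (theta_rev R n) i.+1 *: (starw (theta_rev R n) j *: (g j + s j.+1)))).
    apply: eq_bigr => j _; have leji : (j <= i)%N by rewrite -ltnS.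
    by rewrite (alphaE R leji ltin) scalerDl scalerA.
  rewrite big_split/= -scaler_sumr; congr (_ + _).
  rewrite (bigD1 ord_max)//= eqxx scale1r big1 ?addr0// => j.
  by rewrite -val_eqE/= eq_sym => /negbTE ->; rewrite scale0r.
by rewrite qE ler_pdivrMl// => /le_trans; apply; rewrite le_eqVlt; apply/orP; left;
  apply/eqP; ring.
Qed.

(** The quotient is the Cesaro mean of the increments, counting [T 0] as the first; these tend to
    1/2. *)
Lemma theta_std_cvg : (fun k => ogmg_theta R 0 k / k.+1%:R) @ \oo --> (2^-1 : R).
Proof.
pose T := ogmg_theta R 0.
have TS k : T k.+1 ^+ 2 - T k.+1 = T k ^+ 2 by have := theta_rec R 0 k; rewrite /= mul1r.
have T1 k : 1 <= T k := theta_ge1 R 0 k.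
have Tinc k : 2^-1 <= T k.+1 - T k.
  rewrite leNgt; apply/negP => lt; have := TS k; have := T1 k; have := T1 k.+1; nra.
have Tlow k : k.+1%:R / 2 <= T k.
  elim: k => [|k IH]; first by have := T1 0%N; lra.
  by rewrite -[k.+2%:R]natr1 mulrDl; have := Tinc k; lra.
(* For the increment D, the recursion reads 2 T_k (D - 1/2) = 1/4 - (D - 1/2)^2, and [Tlow] bounds 2
   T_k below by k + 1. *)
have Tup k : T k.+1 - T k <= 2^-1 + k.+1%:R^-1.
  have k0 : 0 < k.+1%:R :> R by rewrite ltr0n.
  rewrite -lerBlDl -[leRHS]mul1r ler_pdivlMr//.
  have D0 : 0 <= T k.+1 - T k - 2^-1 by rewrite subr_ge0.
  have K0 : 0 <= 2 * T k - k.+1%:R by have := Tlow k; lra.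
  have := mulr_ge0 D0 K0; have := sqr_ge0 (T k.+1 - T k - 2^-1); have := TS k; lra.
pose w k := if k is k'.+1 then T k - T k' else T 0%N.
have wcvg : w k @[k --> \oo] --> (2^-1 : R).
  rewrite -(cvg_shiftS w).
  apply: (@squeeze_cvgr _ _ _ _ (fun=> 2^-1) (fun k => 2^-1 + k.+1%:R^-1)).
  - by near=> k; rewrite /w /= Tinc Tup.
  - exact: cvg_cst.
  - rewrite -[X in _ --> X]addr0; apply: cvgD; [exact: cvg_cst|exact: cvg_harmonic].
rewrite [X in X @ _ --> _](_ : _ = arithmetic_mean w); first exact: cesaro.
apply/funext => k; rewrite /arithmetic_mean /= seriesEnat /= [RHS]mulrC; congr (_ / _).
elim: k => [|k IH]; first by rewrite big_nat1.
by rewrite big_nat_recr//= -IH addrC subrK.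
Unshelve. all: by end_near.
Qed.

Lemma theta_last_cvg :
  (fun n => n%:R ^+ 2 / (2 * ogmg_theta R n n ^+ 2)) @ \oo --> (1 : R).
Proof.
rewrite -cvg_shiftS /=.
pose a k := ogmg_theta R 0 k / k.+1%:R; pose b k : R := k.+1%:R^-1.
(* [C k] is theta_n / n for n = k + 1; [c] is its value at [b = 0], [a = 1/2]. *)
pose C k := b k / 2 + Num.sqrt (b k * b k / 4 + 2 * (a k * a k)).
pose c : R := 0 / 2 + Num.sqrt (0 * 0 / 4 + 2 * (2^-1 * 2^-1)).
have c2 : 2 * c * c = 1.
  rewrite /c !mul0r !add0r -mulrA -expr2 sqr_sqrtr ?mulr_ge0 ?invr_ge0//.
  by field.
rewrite [X in X @ _ --> _](_ : _ = fun k => (2 * C k * C k)^-1); last first.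
  apply/funext => k; rewrite eqxx theta_std// /C /a /b.
  set K := k.+1%:R; set T := ogmg_theta R 0 k.
  have K0 : 0 < K by rewrite ltr0n.
  have -> : K^-1 * K^-1 / 4 + 2 * (T / K * (T / K))
      = (K^-1 / 2) ^+ 2 * (1 + 8 * T ^+ 2) by field; rewrite gt_eqF.
  rewrite sqrtrM ?sqr_ge0// sqrtr_sqr ger0_norm ?divr_ge0 ?invr_ge0 ?ltW//.
  have := sqrtr_ge0 (1 + 8 * T ^+ 2); move: (Num.sqrt _) => q q0.
  have q1 : 1 + q != 0 by rewrite gt_eqF// ltr_pwDl.
  by field; rewrite q1 gt_eqF.
have bcvg : b k @[k --> \oo] --> (0 : R) by exact: cvg_harmonic.
have acvg : a k @[k --> \oo] --> (2^-1 : R) by exact: theta_std_cvg.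
have ccvg : C k @[k --> \oo] --> c.
  apply: cvgD; first by apply: cvgM => //; exact: cvg_cst.
  apply: (cvg_comp (fun k => b k * b k / 4 + 2 * (a k * a k)) Num.sqrt);
    last exact: sqrt_continuous.
  apply: cvgD; first by apply: cvgM; [exact: cvgM|exact: cvg_cst].
  by apply: cvgM; [exact: cvg_cst|exact: cvgM].
have Ccvg : 2 * C k * C k @[k --> \oo] --> (1 : R).
  rewrite -[X in _ --> X]c2; apply: cvgM; last exact: ccvg.
  by apply: cvgM; [exact: cvg_cst|exact: ccvg].
have := cvgV (oner_neq0 R) Ccvg; rewrite invr1; exact.
Qed.

End Rate.

Theorem theorem5p5 (R : realType) :
  (forall (d : nat) (f : 'rV[R]_d -> R) (h : 'rV[R]_d -> \bar R),
     convex_function setT f -> smooth 1 f ->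
     proper_fun h -> closed_fun h -> econvex_fun h ->
     let F : 'rV[R]_d -> \bar R := fun z => ((f z)%:E + h z)%E in
     forall (n : nat) (x s : nat -> 'rV[R]_d),
       (2 <= n)%N ->
       composite_ogmg n f h x s ->
       ((enorm (gradient f (x n) + s n) ^+ 2)%:E
          <= (2 * (Num.sqrt 5 - 1) / ogmg_theta R n n ^+ 2)%:E
               * (F (x 0%N) - F (x n)))%E)
  /\
  (fun n : nat => (2 * (Num.sqrt 5 - 1) / ogmg_theta R n n ^+ 2)
                    / (4 * (Num.sqrt 5 - 1) / n%:R ^+ 2)) @ \oo --> (1 : R).

Proof.
split.
  move=> d f h cf sf [hNy [z hz]] _ _ F n x s n2 xs.
  (* The subgradient inequality tested at a point [z] of finite value excludes [+oo]. *)
  have hfin k : (0 < k <= n)%N -> h (x k) \is a fin_num.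
    move=> /xs[_ /(_ z)] H; rewrite fin_numE hNy /=.
    by apply: contraTneq hz => hy; move: H; rewrite hy addye// leye_eq => /eqP ->.
  have c_gt0 : 0 < 2 * (Num.sqrt 5 - 1) / ogmg_theta R n n ^+ 2.
    rewrite divr_gt0 ?exprn_gt0 ?(lt_le_trans _ (theta_ge1 _ _ _))// mulr_gt0//.
    by rewrite subr_gt0 -[ltLHS]sqrtr1 ltr_sqrt// ltr1n.
  have hn := hfin n; rewrite leqnn (ltnW n2) in hn.
  (* [x 0] may lie outside the domain of [h]; the right-hand side is then [+oo]. *)
  rewrite /F; case h0 : (h (x 0%N)) => [r0| |]; last by have := hNy (x 0%N); rewrite h0.
    have hfin' k : (k <= n)%N -> h (x k) = (fine (h (x k)))%:E.
      by case: k => [|k] lekn; [rewrite h0|rewrite fineK// hfin].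
    rewrite hfin'// -!EFinD -EFinM lee_fin enorm_sq.
    have -> : r0 = fine (h (x 0%N)) by rewrite h0.
    apply: (ogmg_rate (x := x) (g := fun k => gradient f (x k)) (phi := fun k => f (x k))
      (eta := fun k => fine (h (x k))) n2).
    - by move=> i ltin; have [] := xs i.+1 ltin.
    - by move=> i j _ _; exact: (cocoercive _ _ cf sf).
    - move=> i j lein j0n; have [_ /(_ (x i))] := xs j j0n.
      have /andP[_ lejn] := j0n.
      by rewrite (hfin' i)// (hfin' j)// -EFinD lee_fin; lra.
  by rewrite addey// -(fineK (hn isT)) -EFinD addye// gt0_muley ?lte_fin// leey.
(* The factor [Num.sqrt 5 - 1] cancels; the two ratios agree once [n] is positive. *)
apply: (cvg_trans _ (@theta_last_cvg R)); apply: near_eq_cvg; near=> n.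
have : n%:R != 0 :> R by rewrite pnatr_eq0 -lt0n; near: n; exact: nbhs_infty_gt.
have : ogmg_theta R n n != 0 by rewrite gt_eqF// (lt_le_trans ltr01)// theta_ge1.
have : Num.sqrt 5 - 1 != 0 :> R.
  by rewrite subr_eq0 gt_eqF// -[ltLHS]sqrtr1 ltr_sqrt// ltr1n.
move: (ogmg_theta _ _ _) n%:R (Num.sqrt 5) => T N q q0 T0 N0.
by field; rewrite T0 N0 q0.
Unshelve. all: by end_near.
Qed.
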